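(* Let $\mathbf P=(P,\le,0,1)$ be a bounded poset satisfying the Descending Chain Condition, let $\mathbf Q=(Q,\le,0)$ be a poset with least element $0$, let $f$ be an up-homomorphism from $\mathbf P$ to $\mathbf Q$, and put $I:=[0](\ker f)=\{x\in P\mid f(x)=f(0)\}$. Then the following holds: (i) $I$ is an ideal of $\mathbf P$; (ii) if $\mathbf P$ satisfies the Ascending Chain Condition and $f^*\colon Q\to\mathbb A(\mathbf P)$ denotes the operator for which $(f,f^* )$ is a pair of operator-residuated mappings between $\mathbf P$ and $\mathbf Q$, then $|f^*(0)|=1$ and $I=[0,f^*(0)]$, where the singleton $f^*(0)$ is identified with its unique element.
   Context: For a poset $(P,\le)$ and $A\subseteq P$: $U(A)$ is the set of all upper bounds of $A$ in $P$, $U(x,y):=U(\{x,y\})$, and $\operatorname{Min}A$ is the set of all minimal elements of $A$. A mapping $f\colon P\to Q$ between posets is an up-homomorphism if $f\big(\operatorname{Min}U(x,y)\big)=\operatorname{Min}U\big(f(x),f(y)\big)$ (equality of subsets of $Q$, the left side being the image of a set under $f$) for all $x,y\in P$. A subset $I$ of $P$ is an ideal of $\mathbf P$ if for all $x,y\in I$ one has $\{z\in P\mid z\le x\}\subseteq I$ and $U(x,y)\cap I\ne\emptyset$. The Ascending (Descending) Chain Condition means that there are no infinite strictly ascending (descending) chains. A bounded poset is one with least element $0$ and greatest element $1$. $\mathbb A(\mathbf P)$ is the set of all non-empty antichains of $\mathbf P$. A pair of operator-residuated mappings between $\mathbf P$ and $\mathbf Q$ is a pair $(f,f^* )$ with $f\colon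 P\to Q$ and $f^*\colon Q\to\mathbb A(\mathbf P)$ such that for all $x\in P$, $y\in Q$: $f(x)\le y$ if and only if there is some $z\in f^*(y)$ with $x\le z$. Such an $f^*$ is uniquely determined by $f$. $[0,e]=\{x\in P\mid 0\le x\le e\}$. *)

(* Defs.v *)
From mathcomp Require Import all_boot all_order.
From mathcomp Require Import classical_sets.

Set Implicit Arguments.
Unset Strict Implicit.
Unset Printing Implicit Defensive.

Local Open Scope order_scope.
Local Open Scope classical_set_scope.

Definition ACC d (P : porderType d) : Prop :=
  ~ exists u : nat -> P, forall n : nat, u n < u n.+1.

Definition DCC d (P : porderType d) : Prop :=
  ~ exists u : nat -> P, forall n : nat, u n.+1 < u n.

Section Poset.
Context {d : Order.disp_t} {P : porderType d}.
Implicit Types A I : set P.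

Definition minimals A : set P :=
  [set x | A x /\ forall y, A y -> y <= x -> y = x].

(* Nonemptiness is not required of an ideal. *)
Definition is_ideal I : Prop :=
  forall x y, I x -> I y ->
    [set z | z <= x] `<=` I /\ ubound [set x; y] `&` I !=set0.

Definition nonempty_antichains : set (set P) :=
  [set A | A !=set0 /\ forall x y, A x -> A y -> x != y -> x >< y].

End Poset.

Section Maps.
Context {d d' : Order.disp_t} {P : porderType d} {Q : porderType d'}.
Implicit Types f : P -> Q.

Definition up_homomorphism f : Prop :=
  forall x y : P,
    f @` minimals (ubound [set x; y]) = minimals (ubound [set f x; f y]).

Definition ker f : P -> P -> Prop := fun x y => f x = f y.

Definition ker_class f (a : P) : set P := [set x | ker f x a].

Definition operator_residuated f (fs : Q -> set P) : Prop :=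
  (forall y : Q, nonempty_antichains (fs y)) /\
  (forall (x : P) (y : Q), f x <= y <-> exists2 z, fs y z & x <= z).

End Maps.

(* Main.v *)
(* Since Min U(x,y) = {y} for x <= y, an up-homomorphism is monotone, so f(0) is
   the least value of f and I is a down-set; for x, y in I the set Min U(f x, f y)
   is {f(0)}, so some minimal upper bound of x and y is mapped to f(0). In (ii),
   f*(0) is non-empty, so f takes the value 0, whence f(0) = 0 and I is the
   down-set generated by f*(0). As I is directed, any two elements of the
   antichain f*(0) lie below a third one, hence coincide. *)
Require Import Defs.
From mathcomp Require Import all_boot all_order.
From mathcomp Require Import classical_sets.

Import Order.Theory.

Local Open Scope order_scope.
Local Open Scope classical_set_scope.

Lemma ubound2P d (P : porderType d) (x y z : P) :
  ubound [set x; y] z <-> x <= z /\ y <= z.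
Proof.
split=> [h|[xz yz] _ [] -> //].
by split; apply: h; [left|right].
Qed.

Lemma minimals_ubound2 d (P : porderType d) (x y : P) :
  x <= y -> minimals (ubound [set x; y]) = [set y].
Proof.
move=> xy; apply/seteqP; split=> [z [/ubound2P[_ yz] zmin]|_ ->] /=.
  by rewrite (zmin y) //; apply/ubound2P.
split=> [|z /ubound2P[_ yz] zy]; first exact/ubound2P.
by apply/le_anti; rewrite zy.
Qed.

Section UpHomomorphism.
Context {d d' : Order.disp_t} {P : porderType d} {Q : porderType d'}.
Context (f : P -> Q) (f_up : up_homomorphism f).

Lemma up_homomorphism_le (x y : P) : x <= y -> f x <= f y.
Proof.
move=> xy; have := f_up x y; rewrite minimals_ubound2 // image_set1 => E.
have : [set f y] (f y) by [].
by rewrite E => -[/ubound2P[]].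
Qed.

(** The only minimal upper bound of [f a] with itself is [f a]; pulling it back along the equality
    of sets gives [z]. Thus every kernel class is directed, not only that of [\bot]. *)
Lemma up_homomorphism_directed (a x y : P) : f x = f a -> f y = f a ->
  exists2 z, x <= z /\ y <= z & f z = f a.
Proof.
move=> fx fy; have := f_up x y.
rewrite fx fy (minimals_ubound2 _ _ (f a)) // => E.
have : [set f a] (f a) by [].
by rewrite -E => -[z [/ubound2P xyz _] fz]; exists z.
Qed.

End UpHomomorphism.

Theorem theorem4p3 (d d' : Order.disp_t) (P : tbPOrderType d)
    (Q : bPOrderType d') (f : P -> Q) :
  DCC P -> up_homomorphism f ->
  is_ideal (ker_class f \bot) /\
  (ACC P -> forall fs : Q -> set P, operator_residuated f fs ->
     exists a : P, fs \bot = [set a] /\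
       ker_class f \bot = [set x | \bot <= x <= a]).
Proof.
move=> _ f_up; split=> [x y fx fy|_ fs [fsA fsP]].
  split=> [z /= zx|].
    have fz0 : f z <= f \bot by rewrite -fx; exact: up_homomorphism_le.
    by apply/le_anti/andP; split=> //; apply: up_homomorphism_le (le0x z).
  have [z xyz fz] := up_homomorphism_directed f f_up _ _ _ fx fy.
  by exists z; split=> //; apply/ubound2P.
have [[a fsa] anti] := fsA \bot.
have fs0 z : fs \bot z -> f z = \bot.
  by move=> fsz; apply/eqP; rewrite -lex0; apply/fsP; exists z.
(* By monotonicity [f \bot] lies below [f a], which is [\bot] because [a] is in [fs \bot]. *)
have f0 : f \bot = \bot.
  by apply/eqP; rewrite -lex0 -(fs0 a fsa); apply: up_homomorphism_le (le0x a).
have fs_le z w : fs \bot z -> fs \bot w -> z <= w -> z = w.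
  move=> fsz fsw zw; apply/eqP/negPn/negP => /(anti _ _ fsz fsw).
  by rewrite /Order.comparable zw.
have fs1 z : fs \bot z -> z = a.
  move=> fsz.
  have [||w [zw aw] fw] := up_homomorphism_directed f f_up \bot z a.
  - by rewrite f0 fs0.
  - by rewrite f0 fs0.
  (* The bound [w] need not lie in [fs \bot], but residuation puts some [b] of [fs \bot] above it;
     the antichain property then identifies both [z] and [a] with [b]. *)
  have /fsP[b fsb wb] : f w <= \bot by rewrite fw f0.
  have zb : z = b by apply: fs_le => //; apply: le_trans wb.
  by rewrite zb; apply/esym/fs_le => //; apply: le_trans wb.
exists a; split; first by apply/seteqP; split=> [z /fs1|_ ->].
apply/seteqP; split=> x /=; rewrite /ker_class /ker /= f0 le0x /=.
  move=> fx; have /fsP[z /fs1 -> //] : f x <= \bot by rewrite fx.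
by move=> xa; apply/eqP; rewrite -lex0; apply/fsP; exists a.
Qed.
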